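(* The equational theory $E$ consisting of the single one-sided distributivity axiom $X \times (Y + Z) = X \times Y + X \times Z$ is subterm-collapse free: for every term $t$ over the signature $\{+,\times\}$ and variables, and every proper subterm $s$ of $t$, we have $t \neq_E s$.
   Context: $+$ and $\times$ are binary function symbols; $=_E$ is the equational theory generated by the axiom (its congruence closure under substitution). A term $s$ is a proper subterm of $t$ if $s = t|_p$ for some position $p \neq \epsilon$ of $t$. *)

(* Defs.v *)
From mathcomp Require Import all_boot.

Set Implicit Arguments.
Unset Strict Implicit.
Unset Printing Implicit Defensive.

(* Terms over the signature {+, x}, with the countably infinite variable set
   indexed by nat. *)
Inductive term : Type :=
| Var of nat
| Add of term & term
| Mul of term & term.

Declare Scope term_scope.
Delimit Scope term_scope with term.
Bind Scope term_scope with term.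
Notation "s + t" := (Add s t) : term_scope.
Notation "s * t" := (Mul s t) : term_scope.

Fixpoint subst (sigma : nat -> term) (t : term) : term :=
  match t with
  | Var x => sigma x
  | Add t1 t2 => Add (subst sigma t1) (subst sigma t2)
  | Mul t1 t2 => Mul (subst sigma t1) (subst sigma t2)
  end.

(* Positions are words over {1, 2} (argument numbers); the empty word is the
   root position, and [subterm_at t p] is None when p is not a position of t. *)
Fixpoint subterm_at (t : term) (p : seq nat) : option term :=
  match p, t with
  | [::], _ => Some t
  | 1 :: q, Add t1 _ | 1 :: q, Mul t1 _ => subterm_at t1 q
  | 2 :: q, Add _ t2 | 2 :: q, Mul _ t2 => subterm_at t2 q
  | _, _ => None
  end.

Definition proper_subterm (s t : term) : Prop :=
  exists p : seq nat, p <> [::] /\ subterm_at t p = Some s.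

Inductive eq_theory (E : term -> term -> Prop) : term -> term -> Prop :=
| eq_axiom l r sigma : E l r -> eq_theory E (subst sigma l) (subst sigma r)
| eq_reflexive t : eq_theory E t t
| eq_symmetric s t : eq_theory E s t -> eq_theory E t s
| eq_transitive s t u : eq_theory E s t -> eq_theory E t u -> eq_theory E s u
| eq_add s1 s2 t1 t2 : eq_theory E s1 t1 -> eq_theory E s2 t2 ->
    eq_theory E (Add s1 s2) (Add t1 t2)
| eq_mul s1 s2 t1 t2 : eq_theory E s1 t1 -> eq_theory E s2 t2 ->
    eq_theory E (Mul s1 s2) (Mul t1 t2).

Definition subterm_collapse_free (E : term -> term -> Prop) : Prop :=
  forall t s : term, proper_subterm s t -> ~ eq_theory E t s.

Inductive left_distributivity : term -> term -> Prop :=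
| LeftDistributivity :
    left_distributivity (Var 0 * (Var 1 + Var 2)) (Var 0 * Var 1 + Var 0 * Var 2).

(* Main.v *)
(* Interpret terms by positive integers, sending + to addition and s * t to
   (|s| + 1)|t|. This is linear in |t|, so both sides of the axiom have the same
   value, while a compound term has a strictly larger value than each of its
   arguments. *)
From mathcomp Require Import all_boot.
Require Import Defs.

Fixpoint weight (t : term) : nat :=
  match t with
  | Var _ => 1
  | Add t1 t2 => weight t1 + weight t2
  | Mul t1 t2 => (weight t1).+1 * weight t2
  end.

Lemma weight_gt0 (t : term) : 0 < weight t.
Proof.
by elim: t => //= s IHs t IHt; rewrite ?addn_gt0 ?muln_gt0 ?IHs ?IHt.
Qed.

Lemma weight_eq_theory (s t : term) :
  eq_theory left_distributivity s t -> weight s = weight t.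
Proof.
elim=> //= [l r sigma [] /=|u v u' _ -> _ -> //|? ? ? ? _ -> _ -> //|? ? ? ? _ -> _ -> //].
(* Only the axiom instance is left: the factor of a product's second argument distributes over the
   sum. *)
by rewrite mulnDr.
Qed.

(** Each step down a position lowers the weight by at least one, so the length of [p] bounds the
    total drop. *)
Lemma leq_weight_subterm (p : seq nat) (t s : term) :
  subterm_at t p = Some s -> weight s + size p <= weight t.
Proof.
elim: p t => [|i p IHp] t /=; first by case: t => [?|? ?|? ?] [<-]; rewrite addn0.
case: i => [|[|[|i]]] //; case: t => [x|a b|a b] //= /IHp le_s;
  rewrite addnS; apply: leq_ltn_trans le_s _.
- by rewrite -addn1 leq_add2l weight_gt0.
- by rewrite leq_pmulr ?weight_gt0.
- by rewrite -add1n leq_add2r weight_gt0.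
(* The successor in [weight] gives strictness here: the excess over [weight b] is
   [weight a * weight b], which is positive. *)
- by rewrite mulSn -[ltnLHS]addn0 ltn_add2l muln_gt0 !weight_gt0.
Qed.

Theorem theorem4p4 : subterm_collapse_free left_distributivity.
Proof.
move=> t s [p [p_neq0 /leq_weight_subterm le_s]] /weight_eq_theory eq_ts.
case: p p_neq0 le_s => // i p _.
by rewrite eq_ts addnS ltnNge leq_addr.
Qed.
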